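(* Let $I\subset\mathbb{R}$ be an interval with interior $I^{\circ}$, let $c>0$, and let $f:I\to\mathbb{R}$ be strongly convex with modulus $c$ and differentiable on $I^{\circ}$. If $A$ is a (bounded) self-adjoint operator on a Hilbert space $\mathcal{H}$ with spectrum $Sp(A)\subset I^{\circ}$, then $$f(\langle Ax,x\rangle)\le\langle f(A)x,x\rangle-c\left(\langle A^2x,x\rangle-\langle Ax,x\rangle^2\right)$$ for each $x\in\mathcal{H}$ with $\|x\|=1$.
   Context: A function $f:I\to\mathbb{R}$ on an interval $I$ is called strongly convex with modulus $c>0$ if $f(\lambda x+(1-\lambda)y)\le\lambda f(x)+(1-\lambda)f(y)-c\lambda(1-\lambda)(x-y)^2$ for all $x,y\in I$ and $\lambda\in[0,1]$. Operators are bounded linear operators on a complex Hilbert space, and $f(A)$ is defined by the functional calculus for self-adjoint operators. *)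

(* Defs.v *)
From HB Require Import structures.
From mathcomp Require Import all_boot all_order all_algebra.
From mathcomp Require Import all_classical all_reals all_analysis.
From mathcomp Require Import complex.

Set Implicit Arguments.
Unset Strict Implicit.
Unset Printing Implicit Defensive.

Import Order.TTheory GRing.Theory Num.Theory Num.Def.
Import numFieldNormedType.Exports.

Local Open Scope classical_set_scope.
Local Open Scope complex_scope.
Local Open Scope ring_scope.

Definition strongly_convex (R : realType) (c : R) (I : set R) (f : R -> R) :=
  forall x y l : R, I x -> I y -> 0 <= l <= 1 ->
    f (l * x + (1 - l) * y) <=
      l * f x + (1 - l) * f y - c * l * (1 - l) * (x - y) ^+ 2.

(* A complex Hilbert space is a complete normed space over R[i] together with
   an inner product (linear in the first argument) inducing its norm. *)
Definition hilbert_dot (R : realType) (H : completeNormedModType R[i])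
    (dot : {dot H for (@conjC R[i])}) :=
  forall x : H, dot x x = `|x| ^+ 2.

Definition bounded_operator (R : realType) (H : completeNormedModType R[i])
    (T : H -> H) :=
  linear T /\ exists M : R, forall x : H, `|T x| <= M%:C * `|x|.

Definition selfadjoint (R : realType) (H : completeNormedModType R[i])
    (dot : {dot H for (@conjC R[i])}) (T : H -> H) :=
  forall x y : H, dot (T x) y = dot x (T y).

Definition spectrum (R : realType) (H : completeNormedModType R[i])
    (T : H -> H) : set R[i] :=
  [set z | ~ exists S : H -> H, [/\ bounded_operator S,
      forall x, S (T x - z *: x) = x & forall x, T (S x) - z *: S x = x]].

Definition op_poly (R : realType) (H : completeNormedModType R[i])
    (T : H -> H) (p : {poly R}) (x : H) : H :=
  \sum_(i < size p) (p`_i)%:C *: iter i T x.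

(* Continuous functional calculus of a self-adjoint operator T (so that the
   spectrum is real): f(T) is the limit in operator norm of p_n(T), for
   polynomials p_n converging to f uniformly on the spectrum of T. *)
Definition is_cfc (R : realType) (H : completeNormedModType R[i])
    (T : H -> H) (f : R -> R) (B : H -> H) :=
  bounded_operator B /\
  exists p : nat -> {poly R},
    (forall e : R, 0 < e -> \forall n \near \oo,
       forall t : R, spectrum T t%:C -> `|(p n).[t] - f t| <= e) /\
    (forall e : R, 0 < e -> \forall n \near \oo,
       forall x : H, `|op_poly T (p n) x - B x| <= e%:C * `|x|).

(* For T bounded self-adjoint and f continuous on the spectrum of T there is
   exactly one B with is_cfc T f B; otherwise the value may be arbitrary. *)
Definition cfc (R : realType) (H : completeNormedModType R[i])
    (T : H -> H) (f : R -> R) : H -> H :=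
  get (is_cfc T f).

(* Main.v *)
Require Import Defs.
From HB Require Import structures.
From mathcomp Require Import all_boot all_order all_algebra.
From mathcomp Require Import all_classical all_reals all_analysis.
From mathcomp Require Import complex.
From mathcomp Require Import ring lra.
Set Implicit Arguments.
Unset Strict Implicit.
Unset Printing Implicit Defensive.
Import Order.TTheory GRing.Theory Num.Theory Num.Def.
Import numFieldNormedType.Exports.
Local Open Scope classical_set_scope.
Local Open Scope complex_scope.
Local Open Scope ring_scope.

(** The inequality is the support-line inequality of [f] with [t] replaced by
    [A].  Put [s = <Ax, x>].  Strong convexity gives, for every [t] in [I],
    [f s + f'(s) (t - s) + c (t - s)^2 <= f t].  The left side is a polynomial
    [q] in [t], and [<q(A)x, x> = f s + c (<A^2 x, x> - s^2)] since [x] is a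
    unit vector.  So everything reduces to two points: [s] lies in the interior
    of [I], and [q <= f] on the spectrum implies [<q(A)x, x> <= <f(A)x, x>].

    Both follow from one fact, [op_poly_form_min]: for a real polynomial [p]
    the quadratic form of [p(A)] is bounded below by [p t] for some [t] in the
    spectrum of [A].  Indeed the infimum [mu] of the form over the unit sphere
    cannot be taken away from [p(A)] without destroying invertibility
    ([form_inf_not_invertible]); splitting [p - mu] into linear factors over the
    complex numbers, one of the factors [A - z] must then fail to be invertible
    ([invertible_poly_op]), and [z] is a point of the spectrum with [p z = mu].
    With [p = 'X] and [p = - 'X] this bounds [<Ax, x>] by points of the
    spectrum; with [p >= 0] on the spectrum it gives [p(A) >= 0], hence the
    comparison above after passing to the limit along the polynomials that
    define [f(A)] ([is_cfc_form_ge]).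

    It remains to see that [f(A)] exists.  Applying positivity to
    [e^2 - p^2] bounds the norm of [p(A)] by the supremum of [|p|] on the
    spectrum ([op_poly_rnorm_le]), so polynomials converging uniformly to [f]
    there give a norm-convergent sequence of operators
    ([is_cfc_of_poly_approx]).  Such polynomials are Bernstein polynomials: the
    spectrum lies in a compact interval with end points in the spectrum
    ([spectrum_hull]), and [f] is Lipschitz on it because the support lines
    bound its slopes by those at the end points.

    As the forms involved are real, the argument runs with the real inner
    product [Re <x, y>] and real-valued norms. *)

(** * Polynomials in a linear map *)

Section PolynomialOperator.
Context {K : fieldType} {V : lmodType K}.
Implicit Types (p q : {poly K}) (x : V).

(** [op_poly] takes real coefficients only; the factorization of a polynomial
    into linear factors needs the complex ones. *)
Definition poly_op (T : V -> V) p x : V := \sum_(i < size p) p`_i *: iter i T x.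

Lemma poly_op_widen n T p x : (size p <= n)%N ->
  poly_op T p x = \sum_(i < n) p`_i *: iter i T x.
Proof.
move=> pn; rewrite /poly_op (big_ord_widen n (fun i => p`_i *: iter i T x)) //.
rewrite big_mkcond /=; apply: eq_bigr => i _; case: ltnP => // /(nth_default _) ->.
by rewrite scale0r.
Qed.

Lemma poly_opD T p q x : poly_op T (p + q) x = poly_op T p x + poly_op T q x.
Proof.
rewrite (poly_op_widen _ _ (size_polyD p q)).
rewrite (poly_op_widen T x (leq_maxl (size p) (size q))).
rewrite (poly_op_widen T x (leq_maxr (size p) (size q))).
by rewrite -big_split; apply: eq_bigr => i _; rewrite coefD scalerDl.
Qed.

Lemma poly_opZ T a p x : poly_op T (a *: p) x = a *: poly_op T p x.
Proof.
rewrite (poly_op_widen _ _ (size_scale_leq a p)) scaler_sumr.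
by apply: eq_bigr => i _; rewrite coefZ scalerA.
Qed.

Lemma poly_opC T a x : poly_op T a%:P x = a *: x.
Proof.
by rewrite (poly_op_widen _ _ (size_polyC_leq1 a)) big_ord1 coefC.
Qed.

Lemma poly_opMX T p x : poly_op T (p * 'X) x = poly_op T p (T x).
Proof.
rewrite (@poly_op_widen (size p).+1); last first.
  by rewrite (leq_trans (size_polyMleq _ _)) // size_polyX addn2.
rewrite big_ord_recl coefMX eqxx scale0r add0r.
by apply: eq_bigr => i _; rewrite coefMX /= -iterSr.
Qed.

Lemma poly_opX T x : poly_op T 'X x = T x.
Proof. by rewrite -['X]mul1r poly_opMX -polyC1 poly_opC scale1r. Qed.

Lemma poly_opN T p x : poly_op T (- p) x = - poly_op T p x.
Proof. by rewrite -(scaleN1r p) poly_opZ scaleN1r. Qed.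

Lemma poly_opT T p x : linear T -> T (poly_op T p x) = poly_op T p (T x).
Proof.
move=> lT.
have T0 : T 0 = 0 by have := lT (-1) 0 0; rewrite !scaleN1r !addNr.
have TD : {morph T : y z / y + z} by move=> y z; have := lT 1 y z; rewrite !scale1r.
rewrite /poly_op (big_morph T TD T0); apply: eq_bigr => i _.
by have := lT p`_i (iter i T x) 0; rewrite !addr0 T0 addr0 -iterSr => ->.
Qed.

Lemma poly_opM T p q x : linear T ->
  poly_op T (p * q) x = poly_op T p (poly_op T q x).
Proof.
move=> lT; elim/poly_ind: p q x => [|p a IH] q x.
  by rewrite mul0r -polyC0 !poly_opC !scale0r.
rewrite mulrDl poly_opD mulrAC poly_opMX IH mul_polyC poly_opZ.
by rewrite poly_opD poly_opMX poly_opC poly_opT.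
Qed.

End PolynomialOperator.

Lemma op_polyE (R : realType) (H : completeNormedModType R[i]) (T : H -> H) p :
  op_poly T p = poly_op T (map_poly (real_complex R) p).
Proof.
apply/funext => x; rewrite /op_poly /poly_op size_map_poly.
by apply: eq_bigr => i _; rewrite coef_map.
Qed.

(** * Polynomial approximation of Lipschitz functions *)
Section Bernstein.
Context {R : realType}.
Implicit Types (h : nat -> R) (u : R).

(** The value at [u] is the expectation of [h S], where [S] counts the heads in
    [n] tosses of a coin of bias [u].  Conditioning on the first toss gives a
    recursion free of binomial coefficients, in which positivity and the
    variance are immediate inductions. *)
Fixpoint bernstein n h : {poly R} :=
  if n is m.+1 then 'X * bernstein m (fun k => h k.+1) + (1 - 'X) * bernstein m h
  else (h 0%N)%:P.

Lemma bernsteinS n h u : (bernstein n.+1 h).[u] =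
  u * (bernstein n (fun k => h k.+1)).[u] + (1 - u) * (bernstein n h).[u].
Proof. by rewrite /= !hornerE. Qed.

Lemma le_bernstein n h1 h2 u : 0 <= u <= 1 ->
  (forall k, (k <= n)%N -> h1 k <= h2 k) ->
  (bernstein n h1).[u] <= (bernstein n h2).[u].
Proof.
move=> /andP[u0 u1]; elim: n h1 h2 => [|n IH] h1 h2 h12.
  by rewrite /= !hornerC h12.
rewrite !bernsteinS lerD // ler_wpM2l ?subr_ge0 // IH // => k kn; apply: h12 => //.
exact: leqW.
Qed.

Lemma bernstein_affine n h a b u :
  (bernstein n (fun k => a + b * h k)).[u] = a + b * (bernstein n h).[u].
Proof.
elim: n h => [|n IH] h; first by rewrite /= !hornerC.
by rewrite !bernsteinS !IH; ring.
Qed.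

(** The second moment about [z] is the variance plus the squared bias. *)
Lemma bernstein_sqr n z u : (bernstein n (fun k => (k%:R - z) ^+ 2)).[u] =
  n%:R * (u * (1 - u)) + (n%:R * u - z) ^+ 2.
Proof.
elim: n z => [|n IH] z; first by rewrite /= hornerC; ring.
rewrite bernsteinS IH.
have -> : (fun k => (k.+1%:R - z) ^+ 2) = (fun k : nat => (k%:R - (z - 1)) ^+ 2).
  by apply/funext => k; rewrite -natr1; congr (_ ^+ 2); ring.
by rewrite IH -natr1; ring.
Qed.

(** Chebyshev's argument: [|k/n - u|] is replaced by the larger
    [d/2 + (k/n - u)^2 / (2d)], whose expectation is controlled by the
    variance, at most [1/n]. *)
Lemma bernstein_approx (g : R -> R) (L : R) : 0 <= L ->
  (forall u v : R, 0 <= u <= 1 -> 0 <= v <= 1 -> `|g u - g v| <= L * `|u - v|) ->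
  forall e : R, 0 < e -> exists p : {poly R}, forall u, 0 <= u <= 1 ->
    `|p.[u] - g u| <= e.
Proof.
move=> L0 gL e e0.
(* [L d <= e], and [n] is taken so large that [1/n <= d^2]; adding 1 to [L]
   covers the case [L = 0]. *)
pose d := e / (L + 1); have L1 : 0 < L + 1 by rewrite ltr_wpDl.
have d0 : 0 < d by rewrite divr_gt0.
have d20 : 0 < 2 * d by rewrite mulr_gt0.
have Ld : L * d <= e by rewrite /d mulrA mulrAC (ler_piMl (ltW e0)) // ler_pdivrMr // mul1r lerDl.
pose n := (Num.truncn (d ^- 2)).+1.
have n_gt : d ^- 2 < n%:R by exact: truncnS_gt.
have n0 : 0 < n%:R :> R by rewrite ltr0n.
have nd : n%:R^-1 <= d ^+ 2.
  by rewrite -[leRHS]invrK lef_pV2 ?posrE ?invr_gt0 ?exprn_gt0 // ltW.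
exists (bernstein n (fun k => g (k%:R / n%:R))) => u u01; have /andP[u0 u1] := u01.
pose C := L * (d / 2); pose D := L / (2 * d * n%:R ^+ 2).
have D0 : 0 <= D by rewrite divr_ge0 // mulr_ge0 ?sqr_ge0 // mulr_ge0 // ltW.
have bnd k : (k <= n)%N -> `|g (k%:R / n%:R) - g u| <= C + D * (k%:R - n%:R * u) ^+ 2.
  move=> kn; have kn01 : 0 <= (k%:R / n%:R : R) <= 1.
    by rewrite divr_ge0 //= ler_pdivrMr // mul1r ler_nat.
  rewrite (le_trans (gL _ _ kn01 u01)) //.
  set y := k%:R / n%:R - u.
  have -> : C + D * (k%:R - n%:R * u) ^+ 2 = L * ((d ^+ 2 + y ^+ 2) / (2 * d)).
    by rewrite /C /D /y; field; rewrite ?gt_eqF // n0 d0.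
  rewrite ler_wpM2l // ler_pdivlMr //.
  by rewrite -(real_normK (num_real y)); have := sqr_ge0 (d - `|y|); lra.
have fin : C + D * (n%:R * (u * (1 - u)) + (n%:R * u - n%:R * u) ^+ 2) <= e.
  rewrite subrr expr0n addr0.
  have -> : D * (n%:R * (u * (1 - u))) = L * (n%:R^-1 * (u * (1 - u)) / (2 * d)).
    by rewrite /D; field; rewrite ?gt_eqF // n0 d0.
  apply: le_trans Ld; rewrite /C -mulrDr ler_wpM2l //.
  rewrite -lerBrDl ler_pdivrMr //.
  have nV : 0 < n%:R^-1 :> R by rewrite invr_gt0.
  have : n%:R^-1 * (u * (1 - u)) <= n%:R^-1.
    by rewrite ler_piMr ?(ltW nV) // mulr_ile1 ?subr_ge0 //; lra.
  by lra.
set h := fun k => g (k%:R / n%:R).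
have upper : (bernstein n h).[u] <= g u + e.
  have := @le_bernstein n h (fun k => (g u + C) + D * (k%:R - n%:R * u) ^+ 2) u u01.
  rewrite bernstein_affine bernstein_sqr => hle; apply: (le_trans (hle _)).
    by move=> k /bnd; rewrite ler_norml => /andP[_]; rewrite /h; lra.
  by rewrite -addrA lerD2l.
have lower : g u - e <= (bernstein n h).[u].
  have := @le_bernstein n (fun k => (g u - C) + (- D) * (k%:R - n%:R * u) ^+ 2) h u u01.
  rewrite bernstein_affine bernstein_sqr => hle; apply: le_trans (hle _).
    by lra.
  by move=> k /bnd; rewrite ler_norml => /andP[+ _]; rewrite /h; lra.
by rewrite ler_norml; apply/andP; split; lra.
Qed.

(** Affine change of variable to the unit interval.  When [a = b], the
    convention that the inverse of 0 is 0 sends everything to [a], which is the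
    desired constant. *)
Lemma lipschitz_poly_approx (f : R -> R) (a b L : R) : 0 <= L ->
  (forall s t, a <= s <= b -> a <= t <= b -> `|f s - f t| <= L * `|s - t|) ->
  forall e : R, 0 < e -> exists p : {poly R}, forall t, a <= t <= b ->
    `|p.[t] - f t| <= e.
Proof.
move=> L0 fL e e0; have [ab|ba] := leP a b; last first.
  by exists 0 => t /andP[at_ tb]; have := le_trans at_ tb; rewrite leNgt ba.
have ba0 : 0 <= b - a by rewrite subr_ge0.
have [||p hp] := @bernstein_approx (fun u => f (a + (b - a) * u)) (L * (b - a)) _ _ e e0.
- by rewrite mulr_ge0.
- move=> u v u01 v01.
  have in_ab w : 0 <= w <= 1 -> a <= a + (b - a) * w <= b.
    by case/andP=> w0 w1; apply/andP; split; nra.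
  rewrite (le_trans (fL _ _ (in_ab _ u01) (in_ab _ v01))) // -mulrA ler_wpM2l //.
  by rewrite opprD addrACA subrr add0r -mulrBr normrM ger0_norm.
exists (p \Po ((b - a)^-1 *: ('X - a%:P))) => t /andP[at_ tb].
rewrite horner_comp !hornerE.
have [ab0|ab0] := eqVneq (b - a) 0.
  have := hp 0; rewrite lexx ler01 mulr0 addr0 ab0 invr0 mul0r => /(_ isT).
  by have -> : t = a by apply/eqP; rewrite eq_le at_ andbT; lra.
have ba_gt0 : 0 < b - a by rewrite lt_neqAle eq_sym ab0.
have -> : f t = f (a + (b - a) * ((b - a)^-1 * (t - a))).
  by rewrite mulVKf // addrC subrK.
apply: hp; rewrite mulrC divr_ge0 ?subr_ge0 //= ler_pdivrMr // mul1r.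
by rewrite lerD2r.
Qed.

End Bernstein.

(** * Support lines of strongly convex functions *)
Section StronglyConvex.
Context {R : realType} (c : R) (I : set R) (f : R -> R).
Hypotheses (c_gt0 : 0 < c) (f_sc : strongly_convex c I f).
Hypothesis f_diff : forall t : R, I° t -> derivable f t 1.

(** Strong convexity between [s] and [t], at the point [s + l (t - s)], bounds
    the difference quotient [(f (s + l (t - s)) - f s) / l] by
    [f t - f s - c (1 - l) (t - s)^2]; then [l] tends to 0. *)
Lemma strongly_convex_support s t : I° s -> I t ->
  f s + 'D_1 f s * (t - s) + c * (t - s) ^+ 2 <= f t.
Proof.
move=> Is It; have Is' := interior_subset Is.
have df := f_diff Is; set D := 'D_1 f s.
have [->|ts] := eqVneq t s; first by rewrite subrr mulr0 expr0n mulr0 !addr0.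
set w := t - s; have w0 : w != 0 by rewrite subr_eq0.
have cD : h^-1 *: (f (h *: w + s) - f s) @[h --> 0^'] --> w * D.
  have dfs : differentiable f s by exact/derivable1_diffP.
  have : derivable f s w by exact: diff_derivable.
  rewrite /derivable => /cvg_ex[l] cl.
  have Dl : 'D_w f s = l by exact: cvg_lim cl.
  have Dw : 'D_w f s = w * D.
    rewrite /D !deriveE // -[in LHS](mulr1 w).
    exact: (linearZ_LR ('d f s) w 1).
  by move: cl; rewrite -Dl Dw.
have key (e : R) : 0 < e -> w * D <= f t - f s - c * w ^+ 2 + e.
  move=> e0; have e20 : 0 < e / 2 by rewrite divr_gt0.
  have /(_ _ (e / 2) e20) := (cvgrPdist_le _ _).1 cD.
  rewrite /= /dnbhs /within /= => /nbhs_ballP[d /= d0 hd].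
  have cw0 : 0 < c * w ^+ 2 by rewrite mulr_gt0 // exprn_even_gt0.
  (* Each entry serves one purpose: a convex combination, membership in the
     neighbourhood where the quotient is close to its limit, and a remainder
     [c l w^2] below [e / 2]. *)
  pose l := Num.min (1 / 2) (Num.min (d / 2) (e / 2 / (c * w ^+ 2))).
  have l0 : 0 < l by rewrite !lt_min !divr_gt0.
  have l1 : l <= 1 / 2 by rewrite ge_min lexx.
  have ld : l <= d / 2 by rewrite !ge_min lexx orbT.
  have le : l * (c * w ^+ 2) <= e / 2 by rewrite -ler_pdivlMr // !ge_min lexx !orbT.
  have : `|w * D - l^-1 * (f (l * w + s) - f s)| <= e / 2.
    apply: hd; last by rewrite gt_eqF.
    by rewrite /ball /= sub0r normrN gtr0_norm //; lra.
  rewrite ler_norml => /andP[_ hl].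
  have : f (l * w + s) <= l * f t + (1 - l) * f s - c * l * (1 - l) * w ^+ 2.
    have -> : l * w + s = l * t + (1 - l) * s by rewrite /w; ring.
    by apply: f_sc => //; lra.
  move=> h; have : l^-1 * (f (l * w + s) - f s) <= f t - f s - c * (1 - l) * w ^+ 2.
    rewrite ler_pdivrMl //; lra.
  by lra.
have : w * D <= f t - f s - c * w ^+ 2 by apply/ler_addgt0Pl => e e0; rewrite addrC key.
by rewrite /D; lra.
Qed.

(** The support lines show that the derivative is monotone, so that slopes on
    [a, b] are bounded by those at the end points, where [f] is still
    differentiable. *)
Lemma strongly_convex_lipschitz a b : a <= b ->
  (forall t, a <= t <= b -> I° t) -> exists2 L, 0 <= L &
  forall s t, a <= s <= b -> a <= t <= b -> `|f s - f t| <= L * `|s - t|.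
Proof.
move=> ab Iab; pose L := `|'D_1 f a| + `|'D_1 f b|.
have Ia : I° a by apply: Iab; rewrite lexx.
have Ib : I° b by apply: Iab; rewrite lexx ab.
have sup s t : I° s -> I° t -> f s + 'D_1 f s * (t - s) <= f t.
  move=> Is /interior_subset It; apply: le_trans (strongly_convex_support Is It).
  by rewrite lerDl mulr_ge0 ?sqr_ge0 // ltW.
have mono s t : I° s -> I° t -> s < t -> 'D_1 f s <= 'D_1 f t.
  move=> Is It st; have := sup _ _ Is It; have := sup _ _ It Is => h1 h2.
  have st0 : 0 < t - s by rewrite subr_gt0.
  by rewrite -(ler_pM2r st0); lra.
have DL s : a <= s <= b -> `|'D_1 f s| <= L.
  move=> sab; have Is := Iab s sab; have /andP[as_ sb] := sab.
  have lo : 'D_1 f a <= 'D_1 f s.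
    by move: as_; rewrite le_eqVlt => /predU1P[->//|]; exact: mono.
  have hi : 'D_1 f s <= 'D_1 f b.
    by move: sb; rewrite le_eqVlt => /predU1P[->//|]; exact: mono.
  have := ler_norm (- 'D_1 f a); have := ler_norm ('D_1 f b).
  have := normr_ge0 ('D_1 f b); have := normr_ge0 ('D_1 f a).
  by rewrite normrN ler_norml /L => *; apply/andP; split; lra.
have one s t : a <= s <= b -> a <= t <= b -> f s - f t <= L * `|s - t|.
  move=> sab tab; have := sup s t (Iab s sab) (Iab t tab) => h.
  apply: le_trans (_ : 'D_1 f s * (s - t) <= _); first by lra.
  rewrite (le_trans (ler_norm _)) // normrM ler_wpM2r //; exact: DL.
exists L => [|s t sab tab]; first by rewrite addr_ge0.
rewrite ler_norml one // andbT lerNl opprB distrC; exact: one.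
Qed.

End StronglyConvex.

(** * The real inner product and the real norm *)
Section Hilbert.
Context {R : realType} {H : completeNormedModType R[i]}.
Context {dot : {dot H for (@conjC R[i])}}.
Hypothesis dot_hilb : hilbert_dot dot.

Definition rdot (x y : H) : R := complex.Re (dot x y).
Definition rnorm (x : H) : R := complex.Re `|x|.

Lemma rnormE x : `|x| = (rnorm x)%:C.
Proof. by rewrite /rnorm RRe_real ?normr_real. Qed.

Lemma rnorm_ge0 x : 0 <= rnorm x.
Proof. by rewrite -lecR -rnormE normr_ge0. Qed.

Lemma rdotxx x : rdot x x = rnorm x ^+ 2.
Proof. by rewrite /rdot dot_hilb rnormE -rmorphXn. Qed.

Lemma dot_conj x y : dot y x = (dot x y)^*%C.
Proof. by rewrite (hermC dot y x) expr0 mul1r. Qed.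

Lemma dotZr_real (a : R) x y : dot x (a%:C *: y) = a%:C * dot x y.
Proof. by rewrite linearZr_LR /=; congr (_ * _); exact: conjc_real. Qed.

Lemma rdotC x y : rdot x y = rdot y x.
Proof. by rewrite /rdot (dot_conj y x); case: (dot y x). Qed.

Lemma rdotDl x y z : rdot (x + y) z = rdot x z + rdot y z.
Proof. by rewrite /rdot linearDl raddfD. Qed.

Lemma rdotZl (a : R) x z : rdot (a%:C *: x) z = a * rdot x z.
Proof.
rewrite /rdot linearZl_LR /=; case: (dot x z) => u v /=.
by rewrite mul0r subr0.
Qed.

Lemma rdotNl x z : rdot (- x) z = - rdot x z.
Proof. by rewrite /rdot linearNl raddfN. Qed.

Lemma rdotBl x y z : rdot (x - y) z = rdot x z - rdot y z.
Proof. by rewrite rdotDl rdotNl. Qed.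

Lemma rdotZr (a : R) x z : rdot z (a%:C *: x) = a * rdot z x.
Proof. by rewrite rdotC rdotZl !(rdotC z). Qed.

Lemma rdotBr x y z : rdot z (x - y) = rdot z x - rdot z y.
Proof. by rewrite rdotC rdotBl !(rdotC z). Qed.

Lemma rdot_selfadjoint T x y : selfadjoint dot T -> rdot (T x) y = rdot x (T y).
Proof. by move=> saT; rewrite /rdot saT. Qed.

Lemma rnorm0 : rnorm 0 = 0.
Proof. by rewrite /rnorm normr0. Qed.

Lemma rnormN x : rnorm (- x) = rnorm x.
Proof. by rewrite /rnorm normrN. Qed.

Lemma rnormB x y : rnorm (x - y) = rnorm (y - x).
Proof. by rewrite /rnorm distrC. Qed.

Lemma rnormD x y : rnorm (x + y) <= rnorm x + rnorm y.
Proof. by rewrite -lecR rmorphD /= -!rnormE ler_normD. Qed.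

Lemma rnormZ (a : R[i]) x : rnorm (a *: x) = complex.Re `|a| * rnorm x.
Proof.
rewrite /rnorm normrZ rnormE.
by case: `|a| => u v /=; rewrite mulr0 subr0.
Qed.

Lemma rnormZr (a : R) x : rnorm (a%:C *: x) = `|a| * rnorm x.
Proof. by rewrite rnormZ normc_def /= expr0n addr0 sqrtr_sqr. Qed.

Lemma rnorm_eq0 x : (rnorm x == 0) = (x == 0).
Proof. by rewrite -(normr_eq0 x) rnormE -(inj_eq (@complexI _)). Qed.

(** Cauchy-Schwarz, from the nonnegative square of [|y| x - |x| y]. *)
Lemma rdot_le x y : rdot x y <= rnorm x * rnorm y.
Proof.
have [->|x0] := eqVneq x 0.
  by rewrite rnorm0 mul0r /rdot linear0l.
have [->|y0] := eqVneq y 0.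
  by rewrite rnorm0 mulr0 rdotC /rdot linear0l.
have nx : 0 < rnorm x by rewrite lt_neqAle rnorm_ge0 eq_sym rnorm_eq0 x0.
have ny : 0 < rnorm y by rewrite lt_neqAle rnorm_ge0 eq_sym rnorm_eq0 y0.
have : 0 <= rdot ((rnorm y)%:C *: x - (rnorm x)%:C *: y)
                 ((rnorm y)%:C *: x - (rnorm x)%:C *: y).
  by rewrite rdotxx sqr_ge0.
rewrite !(rdotBl, rdotBr, rdotZl, rdotZr) !rdotxx (rdotC y x) => h.
have : 0 <= rnorm x * rnorm y * (rnorm x * rnorm y - rdot x y) by nra.
by rewrite pmulr_rge0 ?mulr_gt0 // subr_ge0.
Qed.

Lemma rdot_abs x y : `|rdot x y| <= rnorm x * rnorm y.
Proof.
rewrite ler_norml rdot_le andbT lerNl -rdotNl.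
by rewrite (le_trans (rdot_le _ _)) // rnormN.
Qed.

(** Completeness of the space, freed from radii in the partially ordered
    complex field. *)
Lemma rnorm_complete (u : nat -> H) :
  (forall e : R, 0 < e -> exists N, forall m n, (N <= m)%N -> (N <= n)%N ->
     rnorm (u m - u n) <= e) ->
  exists l, forall e : R, 0 < e -> exists N, forall n, (N <= n)%N ->
     rnorm (u n - l) <= e.
Proof.
move=> uC.
have cu : cvg (u @ \oo).
  apply: cauchy_cvg; apply/cauchy_exP => e e0.
  have eR : e = (complex.Re e)%:C by rewrite RRe_real // gtr0_real.
  have e0' : 0 < complex.Re e by rewrite -ltcR -eR.
  have [|N uN] := uC (complex.Re e / 2); first by rewrite divr_gt0.
  exists (u N); exists N => //= n Nn; rewrite -ball_normE /= rnormE eR ltcR.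
  by rewrite (le_lt_trans (uN _ _ (leqnn _) Nn)) // ltr_pdivrMr // ltr_pMr // ltr1n.
exists (lim (u @ \oo)) => e e0.
have /(_ _ e%:C) [|N _ uN] := (cvgrPdist_le _ _).1 cu; first by rewrite ltcR.
by exists N => n /uN; rewrite rnormE lecR rnormB.
Qed.

(** * Invertible operators *)
Definition invertible_op (T : H -> H) :=
  exists S : H -> H, [/\ bounded_operator S, cancel T S & cancel S T].

Lemma not_spectrum_invertible T z :
  ~ spectrum T z -> invertible_op (fun x => T x - z *: x).
Proof. by move/contrapT. Qed.

Lemma bounded_op_rnorm T : bounded_operator T ->
  exists2 M, 0 < M & forall x, rnorm (T x) <= M * rnorm x.
Proof.
move=> [_ [M hM]]; exists (`|M| + 1); first by rewrite ltr_wpDl.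
move=> x; have := hM x; rewrite !rnormE -rmorphM lecR => /le_trans -> //.
by rewrite ler_wpM2r ?rnorm_ge0 // (le_trans (ler_norm M)) // lerDl.
Qed.

Lemma bounded_op_of_rnorm T M : linear T -> (forall x, rnorm (T x) <= M * rnorm x) ->
  bounded_operator T.
Proof.
move=> lT hM; split=> //; exists M => x.
by rewrite !rnormE -rmorphM lecR.
Qed.

Section Linear.
Variable T : H -> H.
Hypothesis lT : linear T.

Lemma opD x y : T (x + y) = T x + T y.
Proof. by have := lT 1 x y; rewrite !scale1r. Qed.
Lemma op0 : T 0 = 0.
Proof. by apply: (addrI (T 0)); rewrite -opD !addr0. Qed.
Lemma opZ a x : T (a *: x) = a *: T x.
Proof. by have := lT a x 0; rewrite !addr0 op0 addr0. Qed.
Lemma opN x : T (- x) = - T x.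
Proof. by rewrite -scaleN1r opZ scaleN1r. Qed.
Lemma opB x y : T (x - y) = T x - T y.
Proof. by rewrite opD opN. Qed.

Lemma bounded_below_surj_invertible (a : R) : 0 < a ->
  (forall x, a * rnorm x <= rnorm (T x)) -> (forall y, exists x, T x = y) ->
  invertible_op T.
Proof.
move=> a0 Ta /choice[S TS].
have Tinj : injective T.
  move=> x y Txy; apply/eqP; rewrite -subr_eq0 -rnorm_eq0 eq_le rnorm_ge0 andbT.
  by have := Ta (x - y); rewrite opB Txy subrr rnorm0 pmulr_rle0.
have ST x : S (T x) = x by apply: Tinj; rewrite TS.
exists S; split=> //; apply: (@bounded_op_of_rnorm _ a^-1).
  by move=> b x y; apply: Tinj; rewrite opD opZ !TS.
by move=> x; rewrite ler_pdivlMl // (le_trans (Ta _)) // TS.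
Qed.

End Linear.

(** The iterates of [x |-> G x + y] form a Cauchy sequence, its increments
    decaying geometrically; the limit solves [x = G x + y]. *)
Lemma contraction_sub_surjective (G : H -> H) (q : R) : linear G -> 0 <= q < 1 ->
  (forall x, rnorm (G x) <= q * rnorm x) -> forall y, exists x, x - G x = y.
Proof.
move=> lG /andP[q0 q1] Gq y.
pose u n := iter n (fun x => G x + y) 0.
have q1' : 0 < 1 - q by rewrite subr_gt0.
have du n : rnorm (u n.+1 - u n) <= q ^+ n * rnorm y.
  elim: n => [|n IH]; first by rewrite /u /= op0 // add0r subr0 expr0 mul1r.
  have -> : u n.+2 - u n.+1 = G (u n.+1 - u n).
    by rewrite opB //= opprD addrACA subrr addr0.
  rewrite (le_trans (Gq _)) // exprS -mulrA ler_wpM2l //.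
have duk k n : rnorm (u (n + k)%N - u n) <=
    (q ^+ n - q ^+ (n + k)%N) / (1 - q) * rnorm y.
  elim: k => [|k IH]; first by rewrite addn0 !subrr rnorm0 !mul0r.
  have -> : u (n + k.+1)%N - u n = (u (n + k).+1 - u (n + k)%N) + (u (n + k)%N - u n).
    by rewrite addnS addrA subrK.
  rewrite (le_trans (rnormD _ _)) // (le_trans (lerD (du _) IH)) //.
  rewrite -mulrDl ler_wpM2r ?rnorm_ge0 // ler_pdivlMr // mulrDl divfK ?gt_eqF //.
  by rewrite addnS exprS; lra.
have duN n m : (n <= m)%N -> rnorm (u m - u n) <= q ^+ n * (rnorm y / (1 - q)).
  move=> nm; rewrite -(subnKC nm) (le_trans (duk _ _)) // mulrA mulrAC.
  rewrite ler_pM2r ?invr_gt0 // ler_wpM2r ?rnorm_ge0 //.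
  by rewrite gerBl exprn_ge0.
have qlim (e : R) : 0 < e -> exists N, q ^+ N * (rnorm y / (1 - q)) <= e.
  move=> e0; have C0 : 0 < rnorm y / (1 - q) + 1.
    by rewrite ltr_wpDl // divr_ge0 ?rnorm_ge0 // ltW.
  have qq : `|q| < 1 by rewrite ger0_norm.
  have := (cvgrPdist_le _ _).1 (cvg_expr qq) => /(_ _ (e / (rnorm y / (1 - q) + 1))).
  case; first by rewrite divr_gt0.
  move=> N _ /(_ N (leqnn _)) /=; rewrite sub0r normrN ger0_norm ?exprn_ge0 //.
  rewrite ler_pdivlMr // => h; exists N; apply: le_trans h.
  by rewrite ler_wpM2l ?exprn_ge0 // lerDl.
have [|l ul] := @rnorm_complete u.
  move=> e e0; have [N hN] := qlim (e / 2) (divr_gt0 e0 (ltr0Sn _ _)).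
  exists N => m n Nm Nn; have -> : u m - u n = (u m - u N) + (u N - u n).
    by rewrite addrA subrK.
  rewrite (le_trans (rnormD _ _)) // (rnormB (u N)).
  have := duN _ _ Nm; have := duN _ _ Nn; lra.
exists l; apply/eqP; rewrite -subr_eq0 -rnorm_eq0 eq_le rnorm_ge0 andbT.
apply/ler_addgt0Pl => e e0; rewrite addr0.
have [N hN] := ul (e / 2) (divr_gt0 e0 (ltr0Sn _ _)).
have -> : l - G l - y = (l - u N.+1) + G (u N - l).
  by rewrite opB //= opprD (addrA l) [RHS]addrAC [in RHS]addrA subrK.
rewrite (le_trans (rnormD _ _)) // (rnormB l).
have := hN _ (leqnSn N); have := hN _ (leqnn N); have := Gq (u N - l).
have := rnorm_ge0 (u N - l); nra.
Qed.

(** For small [s > 0] the map [x |-> x - s T x] is a contraction, because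
    [|x - s T x|^2 <= (1 - 2 s a + s^2 N^2) |x|^2] when [N] bounds [T].  Hence
    [s T] is onto, and coercivity bounds [T] from below. *)
Lemma lax_milgram T (a : R) : bounded_operator T -> 0 < a ->
  (forall x, a * rnorm x ^+ 2 <= rdot (T x) x) -> invertible_op T.
Proof.
move=> bT a0 Ta; have lT := bT.1; have [N0 N00 TN0] := bounded_op_rnorm bT.
(* Adding [a] to the bound makes the ratio [r = a / N] at most 1. *)
pose N := N0 + a; have N_gt0 : 0 < N by rewrite addr_gt0.
have TN x : rnorm (T x) <= N * rnorm x.
  by rewrite (le_trans (TN0 _)) // ler_wpM2r ?rnorm_ge0 // lerDl ltW.
pose r := a / N; have r0 : 0 < r by rewrite divr_gt0.
have r1 : r <= 1 by rewrite ler_pdivrMr // mul1r lerDr ltW.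
have aN : a = r * N by rewrite divfK ?gt_eqF.
pose s := r / N; have s0 : 0 < s by rewrite divr_gt0.
have rN : r = s * N by rewrite divfK ?gt_eqF.
pose G x := x - s%:C *: T x.
have lG : linear G.
  move=> b x y; rewrite /G lT scalerBr scalerDr !scalerA [s%:C * b]mulrC.
  by rewrite opprD addrACA.
(* With [s = a / N^2] the squared factor is [1 - r^2 <= (1 - r^2 / 2)^2]. *)
have Gq x : rnorm (G x) <= (1 - r ^+ 2 / 2) * rnorm x.
  have r2 : r ^+ 2 <= 1 by rewrite expr_le1 // ltW.
  rewrite -ler_sqr ?nnegrE ?rnorm_ge0 //; last first.
    by rewrite mulr_ge0 ?rnorm_ge0 //; lra.
  rewrite -rdotxx /G !(rdotBl, rdotBr, rdotZl, rdotZr) !rdotxx.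
  rewrite (rdotC x).
  have T2 : s ^+ 2 * rnorm (T x) ^+ 2 <= r ^+ 2 * rnorm x ^+ 2.
    rewrite -!exprMn; apply: lerXn2r; rewrite ?nnegrE.
    - exact: mulr_ge0 (ltW s0) (rnorm_ge0 _).
    - exact: mulr_ge0 (ltW r0) (rnorm_ge0 _).
    - by rewrite rN -[s * N * _]mulrA (ler_pM2l s0).
  have T1 : r ^+ 2 * rnorm x ^+ 2 <= s * rdot (T x) x.
    have -> : r ^+ 2 = s * a by rewrite aN mulrA mulrAC -rN expr2.
    by rewrite -mulrA ler_pM2l.
  have := sqr_ge0 (r ^+ 2 / 2 * rnorm x); nra.
apply: (bounded_below_surj_invertible lT a0).
  move=> x; have [->|x0] := eqVneq x 0; first by rewrite rnorm0 mulr0 rnorm_ge0.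
  have nx : 0 < rnorm x by rewrite lt_neqAle rnorm_ge0 eq_sym rnorm_eq0 x0.
  rewrite -(ler_pM2r nx) -mulrA -expr2 (le_trans (Ta x)) //.
  exact: rdot_le.
move=> y; have [|x] := contraction_sub_surjective lG _ Gq (s%:C *: y).
  have r2 : r ^+ 2 <= 1 by rewrite expr_le1 // ltW.
  by have := exprn_gt0 2 r0; lra.
rewrite /G opprB addrC subrK => /scalerI Txy; exists x; apply: Txy.
by rewrite -[0]/(0%:C) (inj_eq (@complexI _)) gt_eqF.
Qed.

(** For [T >= 0] one has [|T x|^2 <= N <T x, x>], and invertibility bounds
    [|T x|] below by a multiple of [|x|].  Thus 0 cannot be the infimum of the
    form of an invertible nonnegative operator. *)
Lemma invertible_form_ge T : bounded_operator T -> selfadjoint dot T ->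
  (forall x, 0 <= rdot (T x) x) -> invertible_op T ->
  exists2 d, 0 < d & forall x, d * rnorm x ^+ 2 <= rdot (T x) x.
Proof.
move=> bT saT T0 [S [bS TS _]].
have [N N0 TN] := bounded_op_rnorm bT; have [K K0 SK] := bounded_op_rnorm bS.
have lT := bT.1.
exists (K ^+ 2 * N)^-1 => [|x]; first by rewrite invr_gt0 mulr_gt0 ?exprn_gt0.
have h1 : rnorm x ^+ 2 <= K ^+ 2 * rnorm (T x) ^+ 2.
  rewrite -exprMn ler_sqr ?nnegrE ?mulr_ge0 ?rnorm_ge0 ?(ltW K0) //.
  by have := SK (T x); rewrite TS.
have h2 : rnorm (T x) ^+ 2 <= N * rdot (T x) x.
  have s0 : 0 < N^-1 by rewrite invr_gt0.
  (* The multiple of [T x] subtracted from [x] is the one that minimizes the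
     resulting upper bound for the form. *)
  have := T0 (x - N^-1%:C *: T x).
  rewrite opB // opZ // !(rdotBl, rdotBr, rdotZl, rdotZr).
  have -> : rdot (T (T x)) x = rnorm (T x) ^+ 2.
    by rewrite (rdot_selfadjoint _ _ saT) rdotxx.
  rewrite !rdotxx.
  have h3 : rdot (T (T x)) (T x) <= N * rnorm (T x) ^+ 2.
    by rewrite (le_trans (rdot_le _ _)) // expr2 mulrA ler_wpM2r ?rnorm_ge0.
  move=> h.
  have h4 : N^-1 * (N^-1 * rdot (T (T x)) (T x)) <= N^-1 * rnorm (T x) ^+ 2.
    by rewrite ler_pM2l // ler_pdivrMl.
  rewrite -ler_pdivrMl //; lra.
rewrite ler_pdivrMl ?mulr_gt0 ?exprn_gt0 // (le_trans h1) //.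
by rewrite -[K ^+ 2 * N * _]mulrA ler_wpM2l ?sqr_ge0.
Qed.

(** * Polynomials in a bounded operator *)
Lemma bounded_comp (S T : H -> H) :
  bounded_operator S -> bounded_operator T -> bounded_operator (S \o T).
Proof.
move=> bS bT; have [M M0 SM] := bounded_op_rnorm bS.
have [N _ TN] := bounded_op_rnorm bT.
apply: (@bounded_op_of_rnorm _ (M * N)) => [a x y|x] /=; first by rewrite bT.1 bS.1.
by rewrite (le_trans (SM _)) // -mulrA ler_pM2l.
Qed.

Lemma bounded_scale (a : R[i]) : bounded_operator (fun x : H => a *: x).
Proof.
apply: (@bounded_op_of_rnorm _ (complex.Re `|a|)) => [b x y|x].
  by rewrite scalerDr !scalerA mulrC.
by rewrite rnormZ.
Qed.

Lemma bounded_add (S T : H -> H) : bounded_operator S -> bounded_operator T ->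
  bounded_operator (fun x => S x + T x).
Proof.
move=> bS bT; have [M M0 SM] := bounded_op_rnorm bS.
have [N _ TN] := bounded_op_rnorm bT.
apply: (@bounded_op_of_rnorm _ (M + N)) => [a x y|x] /=.
  by rewrite bT.1 bS.1 scalerDr addrACA.
by rewrite (le_trans (rnormD _ _)) // mulrDl lerD.
Qed.

Lemma bounded_poly_op (T : H -> H) p : bounded_operator T ->
  bounded_operator (poly_op T p).
Proof.
move=> bT; elim/poly_ind: p => [|p a IH].
  have -> : poly_op T 0 = fun x => 0 *: x.
    by apply/funext => x; rewrite -polyC0 poly_opC.
  exact: bounded_scale.
have -> : poly_op T (p * 'X + a%:P) = fun x => (poly_op T p \o T) x + a *: x.
  by apply/funext => x; rewrite poly_opD poly_opMX poly_opC.
by apply: bounded_add; [exact: bounded_comp | exact: bounded_scale].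
Qed.

Lemma bounded_op_poly (T : H -> H) p : bounded_operator T ->
  bounded_operator (op_poly T p).
Proof. by rewrite op_polyE; exact: bounded_poly_op. Qed.

Lemma selfadjoint_op_poly (T : H -> H) p : linear T -> selfadjoint dot T ->
  selfadjoint dot (op_poly T p).
Proof.
move=> lT saT; rewrite op_polyE; elim/poly_ind: p => [|p a IH] x y.
  by rewrite rmorph0 -polyC0 !poly_opC !scale0r linear0l linear0r.
rewrite rmorphD rmorphM /= map_polyX map_polyC /= !poly_opD !poly_opMX !poly_opC.
rewrite linearDl linearDr /= IH saT -poly_opT //; congr (_ + _).
by rewrite linearZl_LR dotZr_real.
Qed.

Lemma invertible_comp (S T : H -> H) :
  invertible_op S -> invertible_op T -> invertible_op (S \o T).
Proof.
move=> [S' [bS SS' S'S]] [T' [bT TT' T'T]]; exists (T' \o S').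
by split; [exact: bounded_comp | exact: can_comp | exact: can_comp].
Qed.

Lemma invertible_scale (a : R[i]) : a != 0 -> invertible_op (fun x : H => a *: x).
Proof.
move=> a0; exists (fun x => a^-1 *: x); split; first exact: bounded_scale.
  by move=> x; rewrite scalerA mulVf // scale1r.
by move=> x; rewrite scalerA mulfV // scale1r.
Qed.

(** The half of the spectral mapping theorem that is needed: over the complex
    numbers [q(T)] is a nonzero multiple of a product of operators [T - z] with
    [z] a root of [q]. *)
Lemma invertible_poly_op (T : H -> H) q : bounded_operator T -> q != 0 ->
  (forall z, root q z -> ~ spectrum T z) -> invertible_op (poly_op T q).
Proof.
move=> bT q0; have [r rq] := closed_field_poly_normal q.
have lq : lead_coef q != 0 by rewrite lead_coef_eq0.
move=> hq.
have hr z : root (\prod_(z <- r) ('X - z%:P)) z -> ~ spectrum T z.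
  by move=> rz; apply: hq; rewrite rq rootZ.
rewrite rq {rq hq q0}.
have -> : poly_op T (lead_coef q *: \prod_(z <- r) ('X - z%:P)) =
  (fun x => lead_coef q *: x) \o poly_op T (\prod_(z <- r) ('X - z%:P)).
  by apply/funext => x /=; rewrite poly_opZ.
apply: invertible_comp; first exact: invertible_scale.
elim: r hr => [|z r IH] hr.
  rewrite big_nil; have -> : poly_op T 1 = fun x => 1 *: x.
    by apply/funext => x; rewrite -polyC1 poly_opC.
  exact/invertible_scale/oner_neq0.
have -> : poly_op T (\prod_(z <- z :: r) ('X - z%:P)) =
   (fun x => T x - z *: x) \o poly_op T (\prod_(z <- r) ('X - z%:P)).
  apply/funext => x /=; rewrite big_cons (poly_opM _ _ _ bT.1).
  by rewrite poly_opD poly_opX poly_opN poly_opC.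
apply: invertible_comp.
  by apply/not_spectrum_invertible/hr; rewrite big_cons rootM root_XsubC eqxx.
by apply: IH => w hw; apply: hr; rewrite big_cons rootM hw orbT.
Qed.

(** Were [P - mu] invertible, with [mu] the infimum of the form on the unit
    sphere, its form would be bounded below by some [d > 0], and [mu + d] would
    be a larger lower bound. *)
Lemma form_inf_not_invertible (P : H -> H) (x0 : H) : x0 != 0 -> bounded_operator P ->
  selfadjoint dot P -> exists mu : R,
  (forall x, mu * rnorm x ^+ 2 <= rdot (P x) x) /\
  ~ invertible_op (fun x => P x - mu%:C *: x).
Proof.
move=> x00 bP saP; have [M M0 PM] := bounded_op_rnorm bP.
pose E : set R := [set rdot (P x) x | x in [set x | rnorm x = 1]].
have nrm x : x != 0 -> rnorm ((rnorm x)^-1%:C *: x) = 1.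
  move=> x_neq0; rewrite rnormZr ger0_norm ?invr_ge0 ?rnorm_ge0 //.
  by rewrite mulVf // rnorm_eq0.
have infE : has_inf E.
  split.
    by exists (rdot (P ((rnorm x0)^-1%:C *: x0)) ((rnorm x0)^-1%:C *: x0));
       exists ((rnorm x0)^-1%:C *: x0) => //; exact: nrm.
  exists (- M) => _ [x /= x1 <-].
  have := rdot_abs (P x) x; rewrite x1 mulr1 ler_norml => /andP[+ _].
  by apply: le_trans; rewrite lerN2; have := PM x; rewrite x1 mulr1.
have lb x : inf E * rnorm x ^+ 2 <= rdot (P x) x.
  have [->|x_neq0] := eqVneq x 0.
    by rewrite rnorm0 expr0n mulr0 /rdot linear0r.
  have nx : 0 < rnorm x by rewrite lt_neqAle rnorm_ge0 eq_sym rnorm_eq0 x_neq0.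
  have : inf E <= rdot (P ((rnorm x)^-1%:C *: x)) ((rnorm x)^-1%:C *: x).
    by apply: ge_inf; [exact: infE.2 | exists ((rnorm x)^-1%:C *: x) => //; exact: nrm].
  rewrite (opZ bP.1) rdotZl rdotZr mulrA -invfM -expr2.
  by rewrite ler_pdivlMl ?exprn_gt0 // mulrC.
exists (inf E); split=> // inv.
have bQ : bounded_operator (fun x => P x - (inf E)%:C *: x).
  have -> : (fun x => P x - (inf E)%:C *: x) = (fun x => P x + (- (inf E)%:C) *: x).
    by apply/funext => x; rewrite scaleNr.
  by apply: bounded_add => //; exact: bounded_scale.
have saQ : selfadjoint dot (fun x => P x - (inf E)%:C *: x).
  move=> x y; rewrite linearBl linearBr /= saP; congr (_ - _).
  by rewrite linearZl_LR dotZr_real.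
have QE x : rdot (P x - (inf E)%:C *: x) x = rdot (P x) x - inf E * rnorm x ^+ 2.
  by rewrite rdotBl rdotZl rdotxx.
have [|d d0 hd] := invertible_form_ge bQ saQ _ inv.
  by move=> x; rewrite QE subr_ge0.
have [_ [x /= x1 <-]] := inf_adherent d0 infE.
by have := hd x; rewrite QE x1 expr1n !mulr1; lra.
Qed.

(** * Positivity on the spectrum *)
Section SelfAdjoint.
Variable A : H -> H.
Hypotheses (A_bnd : bounded_operator A) (A_sa : selfadjoint dot A).
Hypothesis A_real : forall z, spectrum A z -> exists t : R, z = t%:C.
Variable x0 : H.
Hypothesis x00 : x0 != 0.

(** The infimum [mu] of the form of [p(A)] is a value of [p] on the spectrum,
    since [p(A) - mu] is not invertible.  Constant polynomials are excluded
    because then [p - mu] may vanish identically, which leaves no root to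
    pick. *)
Lemma op_poly_form_min_nonconst (p : {poly R}) : (1 < size p)%N -> exists2 t : R, spectrum A t%:C &
  forall x, p.[t] * rnorm x ^+ 2 <= rdot (op_poly A p x) x.
Proof.
move=> p1.
have [mu [mulb muN]] := form_inf_not_invertible x00 (bounded_op_poly p A_bnd)
  (selfadjoint_op_poly p A_bnd.1 A_sa).
pose q := map_poly (real_complex R) (p - mu%:P).
have q0 : q != 0.
  rewrite map_poly_eq0 subr_eq0; apply/eqP => pE.
  by move: p1; rewrite pE ltnNge size_polyC_leq1.
apply: contrapT => h; apply: muN.
have -> : (fun x => op_poly A p x - mu%:C *: x) = poly_op A q.
  apply/funext => x; rewrite op_polyE /q rmorphB /= map_polyC.
  by rewrite poly_opD poly_opN poly_opC.
apply: invertible_poly_op => // z qz Az; have [t zt] := A_real Az.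
apply: h; exists t; first by rewrite -zt.
move: qz; rewrite zt /q fmorph_root rootE !hornerE subr_eq0 => /eqP ->.
exact: mulb.
Qed.

(** For a constant polynomial any point of the spectrum will do, and ['X]
    provides one. *)
Lemma op_poly_form_min (p : {poly R}) : exists2 t : R, spectrum A t%:C &
  forall x, p.[t] * rnorm x ^+ 2 <= rdot (op_poly A p x) x.
Proof.
have [p1|p1] := ltnP 1 (size p); first exact: op_poly_form_min_nonconst.
have [|t At _] := @op_poly_form_min_nonconst 'X; first by rewrite size_polyX.
exists t => // x; rewrite (size1_polyC p1) hornerC op_polyE map_polyC poly_opC.
by rewrite rdotZl rdotxx.
Qed.

Lemma op_poly_form_ge0 p : (forall t : R, spectrum A t%:C -> 0 <= p.[t]) ->
  forall x, 0 <= rdot (op_poly A p x) x.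
Proof.
move=> p0 x; have [t At h] := op_poly_form_min p.
by apply: le_trans (h x); rewrite mulr_ge0 ?p0 ?sqr_ge0.
Qed.

(** The extreme values of the form of [A] come from the spectrum by
    [op_poly_form_min] for ['X] and [- 'X].  Below [ab.1] and above [ab.2] the
    operators [A - t] and [t - A] are coercive, hence invertible. *)
Lemma spectrum_hull : exists ab : R * R,
  [/\ spectrum A ab.1%:C, spectrum A ab.2%:C,
      forall t : R, spectrum A t%:C -> ab.1 <= t <= ab.2 &
      forall x, rnorm x = 1 -> ab.1 <= rdot (A x) x <= ab.2].
Proof.
have [a Aa ha] := op_poly_form_min 'X.
have [b Ab hb] := op_poly_form_min (- 'X).
have {}ha x : a * rnorm x ^+ 2 <= rdot (A x) x.
  by have := ha x; rewrite hornerX op_polyE map_polyX poly_opX.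
have {}hb x : rdot (A x) x <= b * rnorm x ^+ 2.
  have := hb x; rewrite hornerN hornerX op_polyE rmorphN /= map_polyX poly_opN.
  by rewrite poly_opX rdotNl mulNr lerN2.
exists (a, b); split => //=; last first.
  by move=> x x1; have := ha x; have := hb x; rewrite x1 expr1n !mulr1 => -> ->.
move=> t At; apply/andP; split; rewrite leNgt; apply/negP => tt; apply: At.
  apply: (@lax_milgram _ (a - t)); last 2 first.
  - by rewrite subr_gt0.
  - by move=> x; rewrite rdotBl rdotZl rdotxx mulrBl lerD2r.
  have -> : (fun x => A x - t%:C *: x) = (fun x => A x + (- t%:C) *: x).
    by apply/funext => x; rewrite scaleNr.
  by apply: bounded_add => //; exact: bounded_scale.
rewrite -/(invertible_op (fun x => A x - t%:C *: x)).
have -> : (fun x => A x - t%:C *: x) =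
    (fun x => (-1) *: x) \o (fun x => (-1) *: A x + t%:C *: x).
  by apply/funext => x /=; rewrite !scaleN1r opprD opprK.
apply: invertible_comp; first by apply: invertible_scale; rewrite oppr_eq0 oner_eq0.
apply: (@lax_milgram _ (t - b)); last 2 first.
- by rewrite subr_gt0.
- move=> x; rewrite rdotDl rdotZl scaleN1r rdotNl rdotxx mulrBl.
  by rewrite [leRHS]addrC lerD2l lerN2.
apply: bounded_add; last exact: bounded_scale.
by apply: (bounded_comp (bounded_scale _)).
Qed.

(** * The continuous functional calculus *)
Lemma op_polyD p q x : op_poly A (p + q) x = op_poly A p x + op_poly A q x.
Proof. by rewrite !op_polyE rmorphD /= poly_opD. Qed.

Lemma op_polyN p x : op_poly A (- p) x = - op_poly A p x.
Proof. by rewrite !op_polyE rmorphN /= poly_opN. Qed.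

Lemma op_polyC a x : op_poly A a%:P x = a%:C *: x.
Proof. by rewrite op_polyE map_polyC poly_opC. Qed.

Lemma op_polyX x : op_poly A 'X x = A x.
Proof. by rewrite op_polyE map_polyX poly_opX. Qed.

Lemma op_polyM p q x : op_poly A (p * q) x = op_poly A p (op_poly A q x).
Proof. by rewrite !op_polyE rmorphM /= (poly_opM _ _ _ A_bnd.1). Qed.

(** [|p(A) x|^2 = <p^2(A) x, x>], and [e^2 - p^2] is nonnegative on the
    spectrum. *)
Lemma op_poly_rnorm_le (p : {poly R}) (e : R) :
  (forall t : R, spectrum A t%:C -> `|p.[t]| <= e) ->
  forall x, rnorm (op_poly A p x) <= e * rnorm x.
Proof.
move=> pe x.
have [t0 At0 _] := op_poly_form_min 'X.
have e0 : 0 <= e by rewrite (le_trans _ (pe _ At0)).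
rewrite -ler_sqr ?nnegrE ?mulr_ge0 ?rnorm_ge0 // exprMn.
have h : forall t : R, spectrum A t%:C -> 0 <= ((e ^+ 2)%:P - p * p).[t].
  move=> t At; rewrite !hornerE subr_ge0 -expr2 -(real_normK (num_real p.[t])).
  by rewrite ler_sqr ?nnegrE ?pe.
have := op_poly_form_ge0 h x.
rewrite op_polyD op_polyN op_polyC op_polyM rdotBl rdotZl.
rewrite (rdot_selfadjoint _ _ (selfadjoint_op_poly p A_bnd.1 A_sa)).
by rewrite !rdotxx subr_ge0.
Qed.

(** Uniform convergence on the spectrum makes the operators [p_n(A)] a Cauchy
    sequence in operator norm; its pointwise limit inherits linearity and
    boundedness. *)
Lemma is_cfc_of_poly_approx (f : R -> R) :
  (forall e : R, 0 < e -> exists p : {poly R},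
     forall t : R, spectrum A t%:C -> `|p.[t] - f t| <= e) ->
  exists B, is_cfc A f B.
Proof.
move=> fp.
have /choice[p hp] : forall n : nat, exists p : {poly R},
    forall t : R, spectrum A t%:C -> `|p.[t] - f t| <= n.+1%:R^-1.
  by move=> n; apply: fp; rewrite invr_gt0.
have inv_small (e : R) : 0 < e -> exists N, forall n, (N <= n)%N -> n.+1%:R^-1 <= e.
  move=> e0; have [N _ hN] := near_infty_natSinv_lt (PosNum e0).
  by exists N => n Nn; exact/ltW/hN.
have lin q : linear (op_poly A q) := (bounded_op_poly q A_bnd).1.
have dist (e : R) : 0 < e -> exists N, forall m n x, (N <= m)%N -> (N <= n)%N ->
    rnorm (op_poly A (p m) x - op_poly A (p n) x) <= e * rnorm x.
  move=> e0; have [N hN] := inv_small (e / 2) (divr_gt0 e0 (ltr0Sn _ _)).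
  exists N => m n x Nm Nn; rewrite -op_polyN -op_polyD.
  apply: op_poly_rnorm_le => t At; rewrite hornerD hornerN.
  have := le_trans (hp m t At) (hN _ Nm); have := le_trans (hp n t At) (hN _ Nn).
  by rewrite !ler_norml => /andP[h1 h2] /andP[h3 h4]; apply/andP; split; lra.
have /choice[B hB] : forall x, exists l, forall e : R, 0 < e ->
    exists N, forall n, (N <= n)%N -> rnorm (op_poly A (p n) x - l) <= e.
  move=> x; apply: rnorm_complete => e e0.
  have x1 : 0 < rnorm x + 1 by rewrite ltr_wpDl ?rnorm_ge0.
  have [N hN] := dist (e / (rnorm x + 1)) (divr_gt0 e0 x1).
  exists N => m n Nm Nn; rewrite (le_trans (hN _ _ _ Nm Nn)) //.
  by rewrite mulrAC ler_pdivrMr // ler_pM2l // lerDl.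
have unif (e : R) : 0 < e -> exists N, forall n, (N <= n)%N ->
    forall x, rnorm (op_poly A (p n) x - B x) <= e * rnorm x.
  move=> e0; have [N hN] := dist e e0; exists N => n Nn x.
  apply/ler_addgt0Pl => d d0; have [M hM] := hB x d d0.
  have -> : op_poly A (p n) x - B x =
      (op_poly A (p (maxn M N)) x - B x) +
      (op_poly A (p n) x - op_poly A (p (maxn M N)) x).
    by rewrite [RHS]addrC addrA subrK.
  rewrite (le_trans (rnormD _ _)) // lerD //; first exact/hM/leq_maxl.
  exact/hN/leq_maxr.
have linB : linear B.
  move=> a x y; apply/eqP; rewrite -subr_eq0 -rnorm_eq0 eq_le rnorm_ge0 andbT.
  apply/ler_addgt0Pl => e e0; rewrite addr0.
  (* [K] collects the norms multiplying the uniform error of [op_poly A (p N)]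
     when it replaces [B]. *)
  pose K := rnorm (a *: x + y) + complex.Re `|a| * rnorm x + rnorm y + 1.
  have a0 : 0 <= complex.Re `|a| by rewrite normc_def /= sqrtr_ge0.
  have K0 : 0 < K.
    have := mulr_ge0 a0 (rnorm_ge0 x); have := rnorm_ge0 y.
    by have := rnorm_ge0 (a *: x + y); rewrite /K; lra.
  have [N hN] := unif (e / K) (divr_gt0 e0 K0).
  have /(_ x) hx := hN N (leqnn N); have /(_ y) hy := hN N (leqnn N).
  have /(_ (a *: x + y)) hxy := hN N (leqnn N).
  have -> : B (a *: x + y) - (a *: B x + B y) =
    - (op_poly A (p N) (a *: x + y) - B (a *: x + y)) +
    (a *: (op_poly A (p N) x - B x) + (op_poly A (p N) y - B y)).
    by rewrite lin opprB scalerBr (addrACA (a *: _)) -opprD addrA subrK.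
  rewrite (le_trans (rnormD _ _)) // rnormN.
  have h := rnormD (a *: (op_poly A (p N) x - B x)) (op_poly A (p N) y - B y).
  rewrite rnormZ in h.
  have := ler_wpM2l a0 hx => h2.
  have : e / K * K = e by rewrite divfK // gt_eqF.
  rewrite {2}/K; have : 0 < e / K by rewrite divr_gt0.
  by move: (e / K) hx hy hxy h2 => d hx hy hxy h2 d0; nra.
have bB : bounded_operator B.
  have [N hN] := unif 1 ltr01.
  have [M M0 hM] := bounded_op_rnorm (bounded_op_poly (p N) A_bnd).
  apply: (@bounded_op_of_rnorm _ (M + 1)) => // x.
  have -> : B x = op_poly A (p N) x - (op_poly A (p N) x - B x).
    by rewrite opprB addrC subrK.
  by rewrite (le_trans (rnormD _ _)) // rnormN mulrDl lerD // hN.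
exists B; split=> //; exists p; split=> e e0.
  have [N hN] := inv_small e e0; exists N => //= n /= Nn t At.
  by rewrite (le_trans (hp n t At)) // hN.
have [N hN] := unif e e0; exists N => //= n /= Nn x.
by rewrite !rnormE -rmorphM lecR hN.
Qed.

Lemma Im_dot x y : complex.Im (dot x y) = - rdot ('i%C *: x) y.
Proof.
by rewrite /rdot linearZl_LR /= mulrC ReiNIm opprK.
Qed.

Lemma dot_self_real (T : H -> H) x : selfadjoint dot T ->
  dot (T x) x = (rdot (T x) x)%:C.
Proof.
move=> saT; have := @dot_conj (T x) x; rewrite -saT /rdot.
case: (dot (T x) x) => u v /= [vv].
by congr (_ +i* _)%C; lra.
Qed.

(** The polynomials [r] approximating [f] satisfy [r + d >= q] on the spectrum
    for every [d > 0] eventually, so positivity applies to [r + d - q].  This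
    holds for any sequence of polynomials converging to [f] on the spectrum,
    whatever it does elsewhere. *)
Lemma is_cfc_form_ge f B (q : {poly R}) x : is_cfc A f B ->
  (forall t : R, spectrum A t%:C -> q.[t] <= f t) ->
  rdot (op_poly A q x) x <= rdot (B x) x.
Proof.
move=> [bB [p [pf pB]]] qf; apply/ler_addgt0Pl => e e0.
have n1 : 0 < 2 * rnorm x ^+ 2 + 1 by rewrite ltr_wpDl // mulr_ge0 ?sqr_ge0.
(* The error [d |x|^2] arises twice, on the spectrum and in operator norm. *)
pose d := e / (2 * rnorm x ^+ 2 + 1); have d0 : 0 < d by rewrite divr_gt0.
have [N1 _ h1] := pf d d0; have [N2 _ h2] := pB d d0.
have {}h1 := h1 (maxn N1 N2) (leq_maxl _ _).
have {}h2 := h2 (maxn N1 N2) (leq_maxr _ _) x.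
move: (p _) h1 h2 => r h1 h2.
have pos : forall t : R, spectrum A t%:C -> 0 <= (r + d%:P - q).[t].
  move=> t At; rewrite !hornerE; have := qf t At; have := h1 t At.
  by rewrite ler_norml => /andP[]; lra.
have := op_poly_form_ge0 pos x.
rewrite !op_polyD op_polyN op_polyC rdotBl rdotDl rdotZl rdotxx.
rewrite !rnormE -rmorphM lecR in h2.
have := rdot_le (op_poly A r x - B x) x; rewrite rdotBl.
have := ler_wpM2r (rnorm_ge0 x) h2; rewrite -mulrA -expr2.
have : d * (2 * rnorm x ^+ 2 + 1) = e by rewrite divfK // gt_eqF.
by nra.
Qed.

(** The form of [p(A)] is real for real [p], and this passes to the limit. *)
Lemma is_cfc_dot_real f B x : is_cfc A f B -> dot (B x) x = (rdot (B x) x)%:C.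
Proof.
move=> [bB [p [_ pB]]].
suff im0 : complex.Im (dot (B x) x) = 0.
  by move: im0; rewrite /rdot; case: (dot (B x) x) => u v /= ->.
apply/eqP; rewrite -normr_eq0 eq_le normr_ge0 andbT.
apply/ler_addgt0Pl => e e0; rewrite addr0.
have n1 : 0 < rnorm x ^+ 2 + 1 by rewrite ltr_wpDl // sqr_ge0.
have [N _ hN] := pB (e / (rnorm x ^+ 2 + 1)) (divr_gt0 e0 n1).
have {}hN := hN N (leqnn N) x; rewrite !rnormE -rmorphM lecR in hN.
have -> : complex.Im (dot (B x) x) = - complex.Im (dot (op_poly A (p N) x - B x) x).
  rewrite linearBl raddfB /= (dot_self_real _ (selfadjoint_op_poly _ A_bnd.1 A_sa)).
  by rewrite sub0r opprK.
rewrite normrN Im_dot normrN (le_trans (rdot_abs _ _)) //.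
have -> : rnorm ('i%C *: (op_poly A (p N) x - B x)) = rnorm (op_poly A (p N) x - B x).
  by rewrite rnormZ normc_def /= expr0n expr1n add0r sqrtr1 mul1r.
apply: le_trans (ler_wpM2r (rnorm_ge0 x) hN) _.
by rewrite -mulrA -expr2 mulrAC ler_pdivrMr // ler_pM2l // lerDl.
Qed.

End SelfAdjoint.

End Hilbert.

(** * The operator inequality *)
Theorem theorem3p3 (R : realType) (I : set R) (c : R) (f : R -> R)
    (H : completeNormedModType R[i]) (dot : {dot H for (@conjC R[i])})
    (A : H -> H)
    (I_itv : is_interval I) (c_gt0 : 0 < c)
    (f_sc : strongly_convex c I f)
    (f_diff : forall t : R, I° t -> derivable f t 1)
    (dot_hilb : hilbert_dot dot)
    (A_bnd : bounded_operator A) (A_sa : selfadjoint dot A)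
    (A_sp : spectrum A `<=` [set t%:C | t in I°])
    (x : H) (x1 : `|x| = 1) :
  (f (complex.Re (dot (A x) x)))%:C <=
    dot (cfc A f x) x - c%:C * (dot (A (A x)) x - dot (A x) x ^+ 2).
Proof.
have A_real z : spectrum A z -> exists t : R, z = t%:C.
  by move=> /A_sp[t _ <-]; exists t.
have A_I (t : R) : spectrum A t%:C -> I° t by move=> /A_sp[s Is /complexI <-].
have x_neq0 : x != 0 by rewrite -normr_eq0 x1 oner_eq0.
have nx : rnorm x = 1 by rewrite /rnorm x1.
have [[a b] /= [Aa Ab hull /(_ x nx) /andP[as_ sb]]] :=
  spectrum_hull dot_hilb A_bnd A_sa A_real x_neq0.
set s := @rdot _ _ dot (A x) x in as_ sb.
have Iab t : a <= t <= b -> I° t.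
  move=> /andP[]; rewrite le_eqVlt => /predU1P[<- _|at_]; first exact: A_I.
  rewrite le_eqVlt => /predU1P[->|tb]; first exact: A_I.
  have t_ab : t \in `]a, b[ by rewrite in_itv /= at_.
  apply: filterS (near_in_itvoo t_ab) => r; rewrite in_itv /= => /andP[ar rb].
  by apply: (I_itv _ _ (interior_subset (A_I _ Aa)) (interior_subset (A_I _ Ab)));
     rewrite (ltW ar) (ltW rb).
have ab := le_trans as_ sb.
have [L L0 fL] := strongly_convex_lipschitz c_gt0 f_sc f_diff ab Iab.
have [B0 cfcB0] : exists B, is_cfc A f B.
  apply: (is_cfc_of_poly_approx dot_hilb A_bnd A_sa A_real x_neq0) => e e0.
  have [p hp] := lipschitz_poly_approx L0 fL e0.
  by exists p => t /hull; exact: hp.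
have cfcB : is_cfc A f (cfc A f) by exact: getPex (ex_intro _ _ cfcB0).
have Is : I° s by apply: Iab; rewrite as_.
(* The support parabola of [f] at [s]. *)
pose q : {poly R} := (f s)%:P + ('D_1 f s)%:P * ('X - s%:P)
  + c%:P * (('X - s%:P) * ('X - s%:P)).
have qf t : spectrum A t%:C -> q.[t] <= f t.
  move=> /A_I /interior_subset It; rewrite /q !(hornerD, hornerM, hornerN, hornerC, hornerX) -expr2.
  exact: (strongly_convex_support c_gt0 f_sc f_diff Is It).
have := is_cfc_form_ge dot_hilb A_bnd A_sa A_real x_neq0 x cfcB qf.
have AAx : dot (A (A x)) x = (@rdot _ _ dot (A (A x)) x)%:C.
  by rewrite /rdot A_sa dot_hilb rnormE -rmorphXn.
rewrite (is_cfc_dot_real dot_hilb A_bnd A_sa x cfcB) (dot_self_real x A_sa) AAx /=.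
rewrite -/s -rmorphXn -rmorphB -rmorphM -rmorphB lecR.
rewrite /q !(op_polyD, op_polyM, op_polyN, op_polyC, op_polyX) //.
rewrite !(opB A_bnd.1) !(opZ A_bnd.1) !(rdotDl, rdotNl, rdotZl, opB A_bnd.1) -/s.
rewrite (rdotxx dot_hilb) nx expr1n.
by lra.
Qed.
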